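(* For every integer $N\ge 2$ there exists an integer $m$ such that the following holds: if a pair $(G,V)$ satisfies the $N$-eigenvalue property with a generating element $g$ having eigenvalues $\lambda_1,\ldots,\lambda_N$ on $V$, and $G$ is finite modulo its center, then the group $\langle \lambda_i\lambda_j^{-1}\rangle\subset\mathbb{C}^\times$ generated by the ratios of eigenvalues of $\rho(g)$ contains a non-trivial root of unity of order less than $m$.
   Context: A pair $(G,V)$ consists of a compact Lie group $G$ and a faithful irreducible finite-dimensional complex representation $\rho\colon G\to \mathrm{GL}(V)$. A finite set $X\subset\mathbb{C}^\times$ satisfies the no-cycle property if for every $n\ge 2$, every primitive $n$-th root of unity $\zeta_n$ and every $u\in\mathbb{C}^\times$, one has $u\langle\zeta_n\rangle\not\subset X$. For a positive integer $N$, the pair $(G,V)$ satisfies the $N$-eigenvalue property with generating element (generator) $g\in G$ if the conjugacy class of $g$ generates $G$ topologically and the spectrum of $\rho(g)$ has exactly $N$ elements and satisfies the no-cycle property. ''Finite modulo its center'' means $G/Z(G)$ is finite. *)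

(* Defs.v *)
From HB Require Import structures.
From mathcomp Require Import all_boot all_order all_algebra.
From mathcomp Require Import complex.
From mathcomp Require Import all_classical all_reals all_analysis.

Set Implicit Arguments.
Unset Strict Implicit.
Unset Printing Implicit Defensive.

Import Order.TTheory GRing.Theory Num.Theory.
Import numFieldNormedType.Exports.

Local Open Scope classical_set_scope.
Local Open Scope ring_scope.

HB.mixin Record isTopologicalGroup G of Group G & Topological G := {
  mulg_continuous : continuous (fun p : G * G => (p.1 * p.2)%g);
  invg_continuous : continuous (fun x : G => (x^-1)%g)
}.

#[short(type="topologicalGroupType")]
HB.structure Definition TopologicalGroup :=
  {G of Group G & Topological G & isTopologicalGroup G}.

Section Lie_groups.
Variable R : realType.

(* Only meant for U open in a finite-dimensional V, where continuity of all
   iterated directional derivatives is the usual C^k condition. *)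
Fixpoint Ck_on (V W : normedModType R) (k : nat) (U : set V) (f : V -> W)
    : Prop :=
  (forall x, U x -> {for x, continuous f}) /\
  if k is k'.+1 then
    (forall x v, U x -> derivable f x v) /\ (forall v, Ck_on k' U ('D_v f))
  else True.

Definition smooth_on (V W : normedModType R) (U : set V) (f : V -> W) :=
  forall k, Ck_on k U f.

(* chart_inv is only relevant on chart_im and chart_map only on chart_dom. *)
Record chart (T : topologicalType) (d : nat) := Chart {
  chart_dom : set T;
  chart_map : T -> 'rV[R]_d;
  chart_inv : 'rV[R]_d -> T
}.

Definition chart_im T d (c : chart T d) : set 'rV[R]_d :=
  chart_map c @` chart_dom c.

Definition is_chart T d (c : chart T d) : Prop :=
  [/\ open (chart_dom c), open (chart_im c),
      forall x, chart_dom c x -> {for x, continuous (chart_map c)},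
      forall y, chart_im c y -> {for y, continuous (chart_inv c)} &
      forall x, chart_dom c x -> chart_inv c (chart_map c x) = x].

Definition smooth_atlas T d (A : set (chart T d)) : Prop :=
  [/\ forall c, A c -> is_chart c,
      forall x, exists2 c, A c & chart_dom c x &
      forall c1 c2, A c1 -> A c2 ->
        smooth_on (chart_map c1 @` (chart_dom c1 `&` chart_dom c2))
                  (chart_map c2 \o chart_inv c1)].

Definition is_lie_group (G : topologicalGroupType) : Prop :=
  hausdorff_space G /\ @second_countable G /\
  exists (d : nat) (A : set (chart G d)),
    [/\ smooth_atlas A,
        forall c1 c2 c3, A c1 -> A c2 -> A c3 ->
          smooth_on
            [set p : 'rV[R]_d * 'rV[R]_d |
              [/\ chart_im c1 p.1, chart_im c2 p.2 &
                  chart_dom c3 (chart_inv c1 p.1 * chart_inv c2 p.2)%g]]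
            (fun p => chart_map c3 (chart_inv c1 p.1 * chart_inv c2 p.2)%g) &
        forall c1 c2, A c1 -> A c2 ->
          smooth_on
            [set y | chart_im c1 y /\ chart_dom c2 (chart_inv c1 y)^-1%g]
            (fun y => chart_map c2 (chart_inv c1 y)^-1%g)].

End Lie_groups.

Section Group_notions.
Variable G : groupType.

Definition generated_subgroup (A : set G) : set G :=
  [set x | forall S : {pred G}, group_closed S ->
     (forall a, A a -> a \in S) -> x \in S].

Definition conjugacy_class (g : G) : set G := [set (g ^ x)%g | x in setT].

Definition group_center : set G := [set z | forall x, commute z x].

Definition finite_modulo_center : Prop :=
  finite_set [set [set (x * z)%g | z in group_center] | x in [set: G]].

End Group_notions.

Section Representations.
Variables (R : realType) (G : topologicalGroupType) (V : vectType R[i]).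
Implicit Type rho : G -> 'End(V).

(* Continuity of all matrix coefficients, which is continuity for the
   canonical topology of End(V); the type R[i]^o carries the topology of C. *)
Definition is_representation rho : Prop :=
  [/\ rho 1%g = \1%VF,
      forall x y, rho (x * y)%g = (rho x \o rho y)%VF &
      forall (l : 'Hom(V, R[i]^o)) (v : V),
        continuous (fun x => l (rho x v) : R[i]^o)].

Definition irreducible_representation rho : Prop :=
  fullv != 0%VS :> {vspace V} /\
  forall U : {vspace V}, (forall x, (rho x @: U <= U)%VS) ->
    U = 0%VS \/ U = fullv.

Definition is_pair rho : Prop :=
  (is_lie_group R G /\ compact [set: G]) /\
  [/\ is_representation rho, injective rho & irreducible_representation rho].

Definition spectrum (f : 'End(V)) : set R[i] := [set a | passmx.leigenvalue f a].

Definition no_cycle (X : set R[i]) : Prop :=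
  forall (n : nat) (z u : R[i]), (2 <= n)%N -> n.-primitive_root z -> u != 0 ->
    ~ ([set u * z ^+ k | k in [set: nat]] `<=` X).

Definition eigenvalue_property (N : nat) rho (g : G) : Prop :=
  [/\ closure (generated_subgroup (conjugacy_class g)) = [set: G],
      (spectrum (rho g) #= `I_N)%card &
      no_cycle (spectrum (rho g))].

End Representations.

(* For A inside C^*, the subgroup of C^* generated by A. A pred S closed under
   division may contain 0, but then S minus 0 is closed under division too. *)
Definition generated_mulgroup (R : realType) (A : set R[i]) : set R[i] :=
  [set z | forall S : {pred R[i]}, divr_closed S ->
     (forall a, A a -> a \in S) -> z \in S].

(* Main.v *)
Require Import Defs.
From HB Require Import structures.
From mathcomp Require Import all_boot all_order all_algebra.
From mathcomp Require Import complex.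
From mathcomp Require Import all_classical all_reals all_analysis.
From mathcomp Require Import lra cyclic separable cyclotomic.

(** Let mu be one of the eigenvalues of rho g.  Since g has finite order modulo
    the center, and the center acts by scalars, the ratios lambda_i / mu are
    roots of unity; let M be their least common exponent.  If a prime p divides
    M, a power of one of the ratios is a primitive p-th root of unity
    ([prime_order_in_generated]).  The point is therefore to bound the smallest prime
    divisor of M by a function of N alone.

    By Dirichlet's pigeonhole argument ([simultaneous_approximation]) there is
    an exponent j > 0, bounded in terms of N, such that all the numbers
    (lambda_i / mu)^j are within 1 / (4N) of 1.  A prime dividing both j and M
    is at most j, so it suffices to show that j and M are not coprime
    ([almost_scalar_power_not_coprime]).  Suppose they are.  Then g is a power
    of h = g^j up to a central factor, while rho h is almost scalar.

    To exploit this, a norm on End(V) is used that is invariant under left and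
    right multiplication by rho(G); it exists because G is compact
    ([biinvariant_norm_exists]).  Such a norm is controlled by eigenvalues
    independently of dim V: the spectral projections of rho g are averages of
    powers of rho g rescaled by unimodular numbers, so they do not increase the
    norm ([spectral_resolution]), and there are at most N of them.  Hence
    multiplication by rho h - mu^j is contracting by a factor 1/4, and for every
    conjugate x of h the commutator [c, x] is at most half as far from 1 as c is
    ([commutator_contraction]).  This is the mechanism of the theorems of
    Jordan and Zassenhaus.

    As G is finite modulo its center, it has finitely many commutators, so among
    those that are not central one can choose c closest to 1.  By contraction all
    commutators of c with the conjugates of h are central
    ([almost_scalar_centralizes]), hence so are the commutators of c with the
    conjugates of g.  These conjugates generate G topologically, so one of the
    commutators is not 1.  By Schur's lemma it is a scalar w <> 1, a root of
    unity, and conjugation shows that the spectrum of rho g is stable under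
    multiplication by w.  This is a cycle, against the hypothesis
    ([central_commutator_cycle]). *)

Set Implicit Arguments.
Unset Strict Implicit.
Unset Printing Implicit Defensive.

Import Order.TTheory GRing.Theory Num.Theory.
Import numFieldNormedType.Exports.
Import Normc.

Local Open Scope classical_set_scope.
Local Open Scope ring_scope.
Local Open Scope complex_scope.

Arguments normc {R} x.
Arguments eq0_normc {R}.

(** * The real-valued modulus of complex numbers *)

Section Modulus.
Variable R : realType.
Implicit Types x y z : R[i].

Lemma normcE0 z : `|z| = (normc z)%:C. Proof. by []. Qed.

Lemma normc_ge0 z : 0 <= normc z.
Proof. by case: z => a b; rewrite sqrtr_ge0. Qed.

Lemma normcX z n : normc (z ^+ n) = normc z ^+ n.
Proof.
elim: n => [|n IHn]; first by rewrite !expr0 normc1.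
by rewrite !exprS normcM IHn.
Qed.

Lemma normcB z y : normc (z - y) = normc (y - z).
Proof. by rewrite -normcN opprB. Qed.

Lemma continuous_normc : continuous (normc : R[i]^o -> R).
Proof.
move=> x; apply/(@cvgrPdist_lt R R R[i]^o (nbhs (x : R[i]^o)) _ normc) => e e0.
have xe : nbhs (x : R[i]^o) (ball (x : R[i]^o) e%:C).
  by apply: nbhsx_ballx; rewrite ltcR.
apply: filterS xe => y; rewrite -ball_normE /= normcE0 ltcR; apply: le_lt_trans.
have dist a b : normc a - normc b <= normc (a - b).
  by rewrite lerBlDr -{1}(subrK b a) le_normcD.
by rewrite ler_norml lerNl opprB normcB !dist normcB dist.
Qed.

Lemma compact_coef_bounded (T : topologicalType) (f : T -> R[i]^o) :
  compact [set: T] -> continuous f -> exists B : R, forall t, normc (f t) <= B.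
Proof.
move=> cT cf; have cN : continuous (fun t => normc (f t)).
  by move=> t; apply: continuous_comp; [exact: cf|exact: continuous_normc].
have /compact_bounded[M [_ hM]] : compact ((fun t => normc (f t)) @` [set: T]).
  by apply: continuous_compact => //; apply: continuous_subspaceT.
exists (M + 1) => t; apply: le_trans (ler_norm _) _.
by apply: (hM (M + 1)); [rewrite ltrDl|exists t].
Qed.
End Modulus.

(** * A norm on End(V) invariant under multiplication by the group *)

Section Norm.
Variables (R : realType) (G : topologicalGroupType) (V : vectType R[i]).
Variable rho : G -> 'End(V).

Record biinvariant_norm (nu : 'End(V) -> R) : Prop := BiinvariantNorm {
  binorm_ge0 : forall A, 0 <= nu A;
  binormD : forall A B, nu (A + B) <= nu A + nu B;
  binormZ : forall a A, nu (a *: A) = normc a * nu A;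
  binorm0_eq0 : forall A, nu A = 0 -> A = 0;
  binormMl : forall x A, nu (rho x \o A)%VF = nu A;
  binormMr : forall x A, nu (A \o rho x)%VF = nu A
}.

(** For any norm on matrices, the supremum over s and t in G of the norm of
    rho s \o A \o rho t is finite by compactness, and reindexing s and t makes it
    invariant on both sides. *)
Lemma biinvariant_norm_exists :
  compact [set: G] -> is_representation rho -> fullv != 0%VS :> {vspace V} ->
  exists nu, biinvariant_norm nu.
Proof.
move=> cG [rho1 rhoM rhoC] V0; set e := vbasis (@fullv _ V).
have be : basis_of fullv e := vbasisP _.
pose I := 'I_(\dim (@fullv _ V)).
pose f (A : 'End(V)) (q : G * G * (I * I)) : R :=
  normc (coord e q.2.1 (rho q.1.1 (A (rho q.1.2 e`_q.2.2)))).
pose nu A := sup (range (f A)).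
have coefb (A : 'End(V)) i j :
    exists B : R, forall x, normc (coord e i (A (rho x e`_j))) <= B.
  pose l : 'Hom(V, R[i]^o) := (linfun (coord e i : V -> R[i]^o) \o A)%VF.
  have [B hB] := compact_coef_bounded cG (rhoC l e`_j).
  by exists B => x; have := hB x; rewrite /l !lfunE /= lfunE.
have fb A : has_ubound (range (f A)).
  have /choice[B1 hB1] : forall ij : I * I, exists B : R,
      forall x, normc (coord e ij.1 (A (rho x e`_ij.2))) <= B.
    by move=> ij; apply: coefb.
  have /choice[B2 hB2] : forall ij : I * I, exists B : R,
      forall x, normc (coord e ij.1 (rho x e`_ij.2)) <= B.
    move=> ij; have [B hB] := coefb \1%VF ij.1 ij.2.
    by exists B => x; have := hB x; rewrite lfunE.
  (* A coordinate of rho s (A (rho t e_j)) is the sum over k of a coordinate of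
     A (rho t e_j), bounded by B1, times one of rho s e_k, bounded by B2. *)
  exists (\sum_i \sum_j \sum_k B1 (k, j) * B2 (i, k)).
  have B1ge0 ij : 0 <= B1 ij by apply: le_trans (hB1 ij 1%g); apply: normc_ge0.
  have B2ge0 ij : 0 <= B2 ij by apply: le_trans (hB2 ij 1%g); apply: normc_ge0.
  move=> _ [[[s t] [i j]] _ <-]; rewrite /f /=.
  rewrite (coord_basis be (memvf (A _))) !linear_sum /=.
  apply: le_trans (_ : \sum_k B1 (k, j) * B2 (i, k) <= _); last first.
    have B12ge0 i' j' : 0 <= \sum_k B1 (k, j') * B2 (i', k).
      by apply: sumr_ge0 => k _; apply: mulr_ge0.
    rewrite [leRHS](bigD1 i) //= [X in _ <= X + _](bigD1 j) //= -addrA lerDl.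
    by rewrite addr_ge0 // sumr_ge0 // => i' _; rewrite sumr_ge0.
  elim/big_ind2: _ => [|x1 x2 y1 y2 h1 h2|k _]; first by rewrite normc0.
    by apply: le_trans (le_normcD _ _) _; apply: lerD.
  rewrite !linearZ /= normcM ler_pM ?normc_ge0 //.
    exact: (hB1 (k, j)).
  exact: (hB2 (i, k)).
have d0 : (0 < \dim (@fullv _ V))%N by rewrite lt0n dimv_eq0.
pose i0 := Ordinal d0.
pose q0 : G * G * (I * I) := (1%g, 1%g, (i0, i0)).
have fne A : range (f A) !=set0 by exists (f A q0); exists q0.
have fle A q : f A q <= nu A by apply: (ub_le_sup (fb A)); exists q.
have nule A b : (forall q, f A q <= b) -> nu A <= b.
  by move=> h; apply: ge_sup => // _ [q _ <-].
have rhoMv x y v : rho x (rho y v) = rho (x * y)%g v by rewrite rhoM lfunE.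
have nu_ge0 A : 0 <= nu A by apply: le_trans (fle A q0); apply: normc_ge0.
have nuZ_le a A : nu (a *: A) <= normc a * nu A.
  apply: nule => q; rewrite /f !lfunE /= !linearZ /= normcM.
  by apply: ler_wpM2l; [exact: normc_ge0|exact: fle].
exists nu; split=> //.
- move=> A B; apply: nule => q; apply: le_trans (lerD (fle A q) (fle B q)).
  by rewrite /f !lfunE /= !linearD /= le_normcD.
- move=> a A; apply/eqP; rewrite eq_le nuZ_le /=.
  have [->|a0] := eqVneq a 0; first by rewrite normc0 mul0r.
  have na0 : 0 < normc a.
    by rewrite lt0r normc_ge0 andbT; apply: contra_neq a0; apply: eq0_normc.
  rewrite -ler_pdivlMl // -normcV -{1}(scalerK a0 A); exact: nuZ_le.
- move=> A A0; apply/lfunP => v.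
  rewrite lfunE /= (coord_basis be (memvf v)) linear_sum.
  rewrite big1 // => j _; rewrite linearZ /= (coord_basis be (memvf (A _))).
  rewrite big1 ?scaler0 // => i _.
  have := fle A (1%g, 1%g, (i, j)); rewrite A0 /f /= rho1 !lfunE /= => h.
  rewrite (_ : coord _ _ _ = 0) ?scale0r //; apply: eq0_normc; apply/eqP.
  by rewrite eq_le h normc_ge0.
- have le x A : nu (rho x \o A)%VF <= nu A.
    apply: nule => -[[s t] ij]; rewrite /f /= lfunE /= rhoMv.
    exact: (fle A (s * x, t, ij)%g).
  move=> x A; apply/eqP; rewrite eq_le le /=; have := le x^-1%g (rho x \o A)%VF.
  by rewrite comp_lfunA -rhoM mulVg rho1 comp_lfun1l.
- have le x A : nu (A \o rho x)%VF <= nu A.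
    apply: nule => -[[s t] ij]; rewrite /f /= lfunE /= rhoMv.
    exact: (fle A (s, x * t, ij)%g).
  move=> x A; apply/eqP; rewrite eq_le le /=; have := le x^-1%g (A \o rho x)%VF.
  by rewrite -comp_lfunA -rhoM mulgV rho1 comp_lfun1r.
Qed.
End Norm.

(** * Eigenvalues, and Schur's lemma *)

Lemma prim_root_exists (F : closedFieldType) n :
  n%:R != 0 :> F -> exists z : F, n.-primitive_root z.
Proof.
move=> nF; have n0 : (0 < n)%N by rewrite lt0n; apply: contra_neq nF => ->.
have [r] := closed_field_poly_normal ('X^n - 1 : {poly F}).
rewrite (monicP (monicXnsubC _ n0)) scale1r => rE.
have /hasP[z _ zn] : has n.-primitive_root r.
  apply: has_prim_root => //.
  - by apply/allP => z; rewrite -root_prod_XsubC -rE.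
  - by rewrite -separable_prod_XsubC -rE separable_Xn_sub_1.
  - by rewrite -ltnS -(size_prod_XsubC r id) -rE size_XnsubC.
by exists z.
Qed.

Lemma cyclic_sum (U : zmodType) n (F : nat -> U) :
  F n = F 0 -> \sum_(l < n) F l.+1 = \sum_(l < n) F l.
Proof.
move=> Fn; apply: (addrI (F 0%N)).
rewrite -[LHS](big_ord_recl n (fun l : 'I_n.+1 => F l)) big_ord_recr /=.
by rewrite Fn addrC.
Qed.

Lemma mem_leigenspace (F : fieldType) (V : vectType F) (f : 'End(V)) a v :
  (v \in passmx.leigenspace f a) = (f v == a *: v).
Proof. by rewrite memv_ker !lfun_simp /= subr_eq0. Qed.

Lemma leigenvalueP (F : fieldType) (V : vectType F) (f : 'End(V)) a :
  reflect (exists2 v, v != 0 & f v = a *: v) (passmx.leigenvalue f a).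
Proof.
apply: (iffP idP) => [E0|[v v0 fv]].
  exists (vpick (passmx.leigenspace f a)); first by rewrite vpick0.
  by apply/eqP; rewrite -mem_leigenspace memv_pick.
apply/eqP => E0; have := mem_leigenspace f a v.
by rewrite E0 memv0 fv eqxx (negbTE v0).
Qed.

Lemma eigenvalue_exists (C : numClosedFieldType) (V : vectType C) (f : 'End(V)) :
  fullv != 0%VS :> {vspace V} -> exists a, passmx.leigenvalue f a.
Proof.
move=> V0; have be := vbasisP (@fullv _ V).
have [|a] := @eigenvalue_closed C _ (passmx.mxof (vbasis fullv) (vbasis fullv) f).
  by rewrite lt0n dimv_eq0.
exists a; rewrite /passmx.leigenvalue (passmx.leigenspaceE be).
by rewrite passmx.vsof_eq0.
Qed.

Section Representation.
Variables (R : realType) (G : topologicalGroupType) (V : vectType R[i]).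
Variable rho : G -> 'End(V).
Local Notation idV := (\1%VF : 'End(V)).
Implicit Types (A f : 'End(V)) (a c : R[i]) (g x : G).
Hypothesis rep : is_representation rho.

Lemma repM x y : rho (x * y)%g = (rho x \o rho y)%VF. Proof. by case: rep. Qed.
Lemma rep1 : rho 1%g = \1%VF. Proof. by case: rep. Qed.

Lemma repX_eigen g a n A : (rho g \o A = a *: A)%VF ->
  (rho (g ^+ n)%g \o A = a ^+ n *: A)%VF.
Proof.
move=> ga; elim: n => [|n IHn]; first by rewrite rep1 expr0 scale1r comp_lfun1l.
by rewrite expgSr repM -comp_lfunA ga -comp_lfunZr IHn scalerA exprS.
Qed.

Lemma schur f : irreducible_representation rho ->
  (forall x, (rho x \o f = f \o rho x)%VF) -> exists a, f = a *: idV.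
Proof.
move=> [V0 irr] fC; have [a fa] := eigenvalue_exists f V0; exists a.
have [|E0|Ef] := irr (passmx.leigenspace f a).
- move=> x; apply/subvP => _ /memv_imgP[v + ->].
  rewrite !mem_leigenspace => /eqP fv.
  by rewrite -comp_lfunE -fC lfunE /= fv linearZ.
- by move: fa; rewrite /passmx.leigenvalue E0 eqxx.
- apply/lfunP => v; have := memvf v; rewrite -Ef mem_leigenspace.
  by move=> /eqP ->; rewrite !lfun_simp.
Qed.

Lemma center_scalar z : irreducible_representation rho -> group_center z ->
  exists a, rho z = a *: idV.
Proof.
by move=> irr zZ; apply: schur => // x; rewrite -!repM; congr rho; apply/esym/zZ.
Qed.

Lemma scalar_center z a : injective rho -> rho z = a *: idV -> group_center z.
Proof.
move=> inj za x; apply: inj; rewrite !repM za.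
by rewrite -comp_lfunZl -comp_lfunZr comp_lfun1l comp_lfun1r.
Qed.

(** * Spectral resolution with norm control *)

Section Nu.
Variable nu : 'End(V) -> R.
Hypothesis nuP : biinvariant_norm rho nu.

Lemma binorm0 : nu 0 = 0.
Proof. by have := binormZ nuP 0 0; rewrite scale0r normc0 mul0r. Qed.

Lemma binormN A : nu (- A) = nu A.
Proof. by rewrite -scaleN1r (binormZ nuP) normcN normc1 mul1r. Qed.

Lemma binorm_sum (I : Type) (r : seq I) (P : pred I) (F : I -> 'End(V)) :
  nu (\sum_(i <- r | P i) F i) <= \sum_(i <- r | P i) nu (F i).
Proof.
elim/big_ind2: _ => [|x1 x2 y1 y2 h1 h2|//]; first by rewrite binorm0.
by apply: le_trans (binormD nuP _ _) _; apply: lerD.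
Qed.

Lemma binorm_gt0 A : A != 0 -> 0 < nu A.
Proof.
move=> A0; rewrite lt0r (binorm_ge0 nuP) andbT.
by apply: contra_neq A0; apply: binorm0_eq0 nuP _.
Qed.

(** Multiplication by rho g preserves nu, and here it multiplies nu A by the
    modulus of a. *)
Lemma modulus_eigen g a A : A != 0 -> (rho g \o A = a *: A)%VF -> normc a = 1.
Proof.
move=> A0 ga; have := binormMl nuP g A; rewrite ga (binormZ nuP).
move/eqP; rewrite -subr_eq0 -[X in _ - X]mul1r -mulrBl mulf_eq0.
by rewrite (gt_eqF (binorm_gt0 A0)) orbF subr_eq0 => /eqP.
Qed.

Lemma modulus_eigenvalue g a : passmx.leigenvalue (rho g) a -> normc a = 1.
Proof.
move=> ga; apply: (@modulus_eigen g _ (projv (passmx.leigenspace (rho g) a))).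
  apply: contra_neq ga => p0.
  apply/eqP; rewrite -subv0; apply/subvP => v vE.
  by rewrite -(projv_id vE) p0 lfunE /= mem0v.
apply/lfunP => v; rewrite !lfunE /=.
have := memv_proj (passmx.leigenspace (rho g) a) v.
by rewrite mem_leigenspace => /eqP.
Qed.

(** With rho g ^ n = c, the projection to the eigenspace of an n-th root a of c is
    the average of a^-l rho(g^l) for l < n.  All these a have modulus 1, so
    composing with an average of norm-preserving maps does not increase nu.
    The list r keeps only those n-th roots that are eigenvalues. *)
Lemma spectral_resolution g n c :
  fullv != 0%VS :> {vspace V} -> (0 < n)%N -> rho (g ^+ n)%g = c *: idV ->
  exists (r : seq R[i]) (P : R[i] -> 'End(V)),
    [/\ uniq r /\ (forall a, a \in r -> passmx.leigenvalue (rho g) a),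
        \1%VF = \sum_(a <- r) P a,
        forall a, a \in r -> (rho g \o P a = a *: P a)%VF,
        forall a A, a \in r -> nu (P a \o A)%VF <= nu A &
        forall a A, a \in r -> nu (A \o P a)%VF <= nu A].
Proof.
move=> V0 n0 gn.
have id0 : \1%VF != 0 :> 'End(V).
  apply: contra_neq V0 => i0; apply/eqP; rewrite -subv0; apply/subvP => v _.
  by rewrite -(id_lfunE v) i0 lfunE /= mem0v.
have n0' : n%:R != 0 :> R[i] by rewrite pnatr_eq0 -lt0n.
have [z zn] := prim_root_exists n0'.
pose m0 : R[i] := n.-root c; have m0n : m0 ^+ n = c by apply: rootCK.
have c1 : normc c = 1.
  apply: (modulus_eigen id0 (_ : rho (g ^+ n)%g \o _ = _)%VF).
  by rewrite comp_lfun1r.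
have z1 : normc z = 1.
  apply/eqP; rewrite -(@pexpr_eq1 _ _ n) ?normc_ge0 //.
  by rewrite -normcX (prim_expr_order zn) normc1.
have m1 : normc m0 = 1.
  by apply/eqP; rewrite -(@pexpr_eq1 _ _ n) ?normc_ge0 // -normcX m0n c1.
have nz (x : R[i]) : normc x = 1 -> x != 0.
  move=> x1; apply/eqP => x0; move: x1 (@oner_neq0 R).
  by rewrite x0 normc0 => ->; rewrite eqxx.
pose P a := n%:R^-1 *: \sum_(l < n) a ^- l *: rho (g ^+ l)%g.
pose r0 := [seq m0 * z ^+ k | k <- iota 0 n].
have ur0 : uniq r0.
  rewrite map_inj_in_uniq ?iota_uniq // => i j.
  rewrite !mem_iota !add0n => /andP[_ i_n] /andP[_ j_n] /(mulfI (nz _ m1)) /eqP.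
  by rewrite (eq_prim_root_expr zn) !modn_small // => /eqP.
have r0P a : a \in r0 -> normc a = 1 /\ a ^+ n = c.
  move=> /mapP[k _ ->]; rewrite normcM normcX m1 z1 expr1n mulr1; split=> //.
  by rewrite exprMn m0n exprAC (prim_expr_order zn) expr1n mulr1.
have r0sum : \sum_(a <- r0) P a = \1%VF.
  rewrite big_map /P -scaler_sumr exchange_big /=.
  have -> : iota 0 n = index_iota 0 n by rewrite /index_iota subn0.
  rewrite (bigD1 (Ordinal n0)) //= [X in _ + X]big1 ?addr0 => [|l l0].
    rewrite (eq_bigr (fun=> \1%VF)) => [|k _]; last first.
      by rewrite expg0 rep1 expr0 invr1 scale1r.
    rewrite big_const_nat subn0 iter_addr_0 -(scaler_nat n idV) scalerA.
    by rewrite mulVf // scale1r.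
  (* The coefficient of rho(g^l) is a geometric sum of the powers of z^-l. *)
  rewrite -scaler_suml (_ : \sum_(_ <= _ < _) _ = 0) ?scale0r //.
  under eq_bigr => k _ do rewrite exprMn invfM exprAC -(exprVn (z ^+ l)).
  rewrite -mulr_sumr (_ : \sum_(_ <= _ < _) _ = 0) ?mulr0 //.
  have zl1 : (z ^+ l)^-1 - 1 != 0.
    rewrite subr_eq0 invr_eq1 -(prim_order_dvd zn) gtnNdvd //.
    by rewrite lt0n; apply: contra l0 => /eqP l0; apply/eqP/val_inj.
  apply: (mulfI zl1); rewrite mulr0 big_mkord -subrX1 exprVn exprAC.
  by rewrite (prim_expr_order zn) expr1n invr1 subrr.
have PE a : a \in r0 -> (rho g \o P a = a *: P a)%VF.
  move=> /r0P[/nz a0 an].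
  rewrite /P -comp_lfunZr scalerA mulrC -scalerA; congr (_ *: _).
  apply/lfunP => v; rewrite comp_lfunE scale_lfunE !sum_lfunE linear_sum /=.
  have e1 (l : 'I_n) : rho g ((a ^- l *: rho (g ^+ l)%g) v) =
      a *: (a ^- l.+1 *: rho (g ^+ l.+1)%g v).
    rewrite !lfunE /= linearZ scalerA /= exprS invfM mulrA divff // mul1r.
    by rewrite expgS repM lfunE.
  under eq_bigr => l _ do rewrite e1.
  rewrite -scaler_sumr; congr (_ *: _).
  under [RHS]eq_bigr => l _ do rewrite lfunE /=.
  apply: (cyclic_sum (F := fun l => a ^- l *: rho (g ^+ l)%g v)).
  rewrite an gn expr0 invr1 scale1r expg0 rep1 !lfunE /= lfunE /= scalerA.
  rewrite mulVf ?scale1r //.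
  by apply: nz.
have PE0 a : a \in r0 -> ~~ passmx.leigenvalue (rho g) a -> P a = 0.
  move=> ar0 na; apply/lfunP => v; rewrite [RHS]lfunE; apply/eqP.
  apply: contraNT na => Pv0; apply/leigenvalueP; exists (P a v) => //.
  by rewrite -comp_lfunE PE // scale_lfunE.
pose r := [seq a <- r0 | passmx.leigenvalue (rho g) a].
have rr0 a : a \in r -> a \in r0 by rewrite mem_filter => /andP[].
have bnd (F : 'I_n -> 'End(V)) A a : a \in r0 -> (forall l, nu (F l) = nu A) ->
    nu (n%:R^-1 *: \sum_(l < n) a ^- l *: F l) <= nu A.
  move=> /r0P[a1 _] hF; rewrite (binormZ nuP) normcV.
  have -> : normc (n%:R : R[i]) = n%:R.
    by rewrite -(mulr_natl 1) mulr1 normcMn normc1.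
  rewrite ler_pdivrMl ?ltr0n //; apply: le_trans (binorm_sum _ _ _) _.
  rewrite (eq_bigr (fun=> nu A)) => [|l _].
    by rewrite sumr_const card_ord mulr_natl.
  by rewrite (binormZ nuP) normcV normcX a1 expr1n invr1 mul1r.
exists r, P; split.
- split; first exact: filter_uniq.
  by move=> a; rewrite mem_filter => /andP[].
- rewrite big_filter -r0sum [LHS](bigID (passmx.leigenvalue (rho g))) /=.
  rewrite [X in _ + X]big_seq_cond [X in _ + X]big1 ?addr0 //.
  by move=> a /andP[]; exact: PE0.
- by move=> a /rr0; apply: PE.
- move=> a A /rr0 ar; rewrite /P -comp_lfunZl.
  have -> : ((\sum_(l < n) a ^- l *: rho (g ^+ l)%g) \o A =
    \sum_(l < n) a ^- l *: (rho (g ^+ l)%g \o A))%VF.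
    apply/lfunP => v; rewrite comp_lfunE !sum_lfunE; apply: eq_bigr => l _.
    by rewrite !scale_lfunE !comp_lfunE.
  by apply: bnd => // l; apply: (binormMl nuP).
- move=> a A /rr0 ar; rewrite /P -comp_lfunZr.
  have -> : (A \o (\sum_(l < n) a ^- l *: rho (g ^+ l)%g) =
    \sum_(l < n) a ^- l *: (A \o rho (g ^+ l)%g))%VF.
    apply/lfunP => v; rewrite comp_lfunE !sum_lfunE linear_sum.
    apply: eq_bigr => l _.
    by rewrite !scale_lfunE linearZ comp_lfunE.
  by apply: bnd => // l; apply: (binormMr nuP).
Qed.
Lemma resolution_power g (r : seq R[i]) (P : R[i] -> 'End(V)) k :
  idV = \sum_(a <- r) P a ->
  (forall a, a \in r -> (rho g \o P a = a *: P a)%VF) ->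
  rho (g ^+ k)%g = \sum_(a <- r) a ^+ k *: P a.
Proof.
move=> r1 gP; rewrite -[LHS]comp_lfun1r r1.
rewrite (big_morph _ (comp_lfunDr (rho (g ^+ k)%g)) (comp_lfun0r _ _)).
by apply: eq_big_seq => a ar; rewrite (repX_eigen _ (gP a ar)).
Qed.

End Nu.
End Representation.

(** * Simultaneous approximation *)

Section Dirichlet.
Variable R : realType.

Lemma truncn_eq_dist (x y : R) : 0 <= x -> 0 <= y ->
  Num.truncn x = Num.truncn y -> `|x - y| < 1.
Proof.
move=> x0 y0 xy; have := truncn_itv x0; have := truncn_itv y0; rewrite xy -natr1.
move=> /andP[y1 y2] /andP[x1 x2]; rewrite ltr_norml; apply/andP; split; lra.
Qed.

Lemma normc_le_ReIm (z : R[i]) : normc z <= `|complex.Re z| + `|complex.Im z|.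
Proof.
case: z => a b /=; rewrite -(ger0_norm (addr_ge0 (normr_ge0 a) (normr_ge0 b))).
rewrite -sqrtr_sqr ler_wsqrtr // sqrrD !real_normK ?num_real //.
by rewrite addrAC lerDl mulrn_wge0 // mulr_ge0.
Qed.

Lemma Re_Im_le (z : R[i]) :
  `|complex.Re z| <= normc z /\ `|complex.Im z| <= normc z.
Proof.
by case: z => a b /=; split; rewrite -sqrtr_sqr ler_wsqrtr // ?lerDl ?lerDr sqr_ge0.
Qed.

(** Cut the square [-1, 1]^2 into cells of side 1 / L; two of the vectors
    (u_i ^ k)_i with k at most the number of N-tuples of cells fall into the same
    tuple of cells, and the quotient of the two is close to 1. *)
Lemma simultaneous_approximation (N : nat) (eps : R) : 0 < eps ->
  exists Q : nat, forall u : 'I_N -> R[i], (forall i, normc (u i) = 1) ->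
    exists2 j, (0 < j <= Q)%N & forall i, normc (u i ^+ j - 1) <= eps.
Proof.
move=> e0; pose L := (Num.truncn (2 / eps)).+1.
have L0 : 0 < L%:R :> R by rewrite ltr0n.
have Leps : 2 / L%:R <= eps.
  by rewrite ler_pdivrMr // mulrC -ler_pdivrMr // ltW // truncnS_gt.
pose cell (x : R) : 'I_(2 * L).+1 := inord (Num.truncn ((x + 1) * L%:R)).
have cellP (x y : R) : `|x| <= 1 -> `|y| <= 1 -> cell x = cell y ->
    `|x - y| <= 1 / L%:R.
  move=> x1 y1.
  have pos (t : R) : `|t| <= 1 -> 0 <= (t + 1) * L%:R :> R.
    by rewrite ler_norml => /andP[h _]; rewrite mulr_ge0 ?ler0n // -lerBlDr sub0r.
  have sml (t : R) : `|t| <= 1 -> (Num.truncn ((t + 1) * L%:R) < (2 * L).+1)%N.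
    move=> t1; rewrite ltnS -(ler_nat R).
    apply: (@le_trans _ _ ((t + 1) * L%:R)); first by rewrite truncn_le pos.
    rewrite natrM ler_wpM2r ?ler0n //; move: t1; rewrite ler_norml => /andP[_ h].
    by rewrite -[2]/(1 + 1) lerD2r.
  move=> /(congr1 val); rewrite /= !inordK ?sml // => /truncn_eq_dist h.
  rewrite ler_pdivlMr // -(ger0_norm (ltW L0)) -normrM mulrBl ltW //.
  have -> : x * L%:R - y * L%:R = (x + 1) * L%:R - (y + 1) * L%:R.
    by rewrite !mulrDl opprD addrACA subrr addr0.
  by apply: h; apply: pos.
pose T := {ffun 'I_N -> 'I_(2 * L).+1 * 'I_(2 * L).+1}.
exists #|{: T}| => u u1.
pose F (k : 'I_#|{: T}|.+1) : T :=
  [ffun i => (cell (complex.Re (u i ^+ k)), cell (complex.Im (u i ^+ k)))].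
have /injectivePn[a [b ab Fab]] : ~~ injectiveb F.
  by apply/negP => /injectiveP /leq_card; rewrite card_ord ltnn.
wlog ltab : a b ab Fab / (a < b)%N.
  move=> W; have [lt|lt|eq] := ltngtP a b; first exact: (W a b).
    by apply: (W b a) => //; rewrite eq_sym.
  by move: ab; rewrite (val_inj eq) eqxx.
exists (b - a)%N.
  by rewrite subn_gt0 ltab /=; apply: leq_trans (leq_subr _ _) _; rewrite -ltnS.
move=> i; have uX k : normc (u i ^+ k) = 1 by rewrite normcX u1 expr1n.
have -> : normc (u i ^+ (b - a) - 1) = normc (u i ^+ b - u i ^+ a).
  by rewrite -[LHS]mul1r -(uX a) -normcM mulrBr mulr1 -exprD subnKC // ltnW.
have := congr1 (fun f : T => f i) Fab; rewrite !ffunE => -[reE imE].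
apply: le_trans Leps; apply: le_trans (normc_le_ReIm _) _.
have re1 k : `|complex.Re (u i ^+ k)| <= 1 by rewrite -(uX k) (Re_Im_le _).1.
have im1 k : `|complex.Im (u i ^+ k)| <= 1 by rewrite -(uX k) (Re_Im_le _).2.
rewrite (_ : 2 = 1 + 1 :> R) // mulrDl !raddfB /=.
by apply: lerD; apply: cellP; rewrite ?reE ?imE ?re1 ?im1.
Qed.
End Dirichlet.

(** * Groups finite modulo their center *)

Section Center.
Variable G : groupType.
Implicit Types x y g c : G.

Lemma coset_center x y :
  [set (x * z)%g | z in group_center (G:=G)] =
    [set (y * z)%g | z in group_center (G:=G)] ->
  exists2 z, group_center z & x = (y * z)%g.
Proof.
move=> xy; have : [set (x * z)%g | z in group_center (G:=G)] x.
  by exists 1%g; [move=> t; rewrite /commute mul1g mulg1|rewrite mulg1].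
by rewrite xy => -[z zZ <-]; exists z.
Qed.

Lemma group_centerV x : group_center x -> group_center (x^-1)%g.
Proof. by move=> hx t; apply/commute_sym/commuteV/commute_sym/hx. Qed.

Lemma group_centerX x n : group_center x -> group_center (x ^+ n)%g.
Proof. by move=> hx t; apply/commute_sym/commuteX/commute_sym/hx. Qed.

Lemma finite_order_mod_center g : finite_modulo_center G ->
  exists2 n, (0 < n)%N & group_center (g ^+ n)%g.
Proof.
move=> fin; pose phi (k : nat) := [set ((g ^+ k) * z)%g | z in group_center (G:=G)].
have ninj : ~ injective phi.
  move=> inj; apply: infinite_nat.
  apply: sub_finite_set (finite_preimage _ fin); last first.
    by move=> x y _ _; apply: inj.
  by move=> k _; exists (g ^+ k)%g.
have [a [b [ltab ab]]] : exists a b, (a < b)%N /\ phi a = phi b.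
  apply: contrapT => H; apply: ninj => a b ab.
  have [lt|lt|//] := ltngtP a b; case: H; [by exists a, b|by exists b, a].
have [z zZ] := coset_center (esym ab).
rewrite -{1}(subnKC (ltnW ltab)) expgnDr => /mulgI gz.
by exists (b - a)%N; rewrite ?subn_gt0 // gz.
Qed.

Lemma commg_center x y z w : group_center z -> group_center w ->
  [~ x * z, y * w]%g = [~ x, y]%g.
Proof.
have fixZ (u t : G) : group_center u -> (t ^ u = t)%g.
  by move=> uZ; rewrite conjgE -uZ mulKg.
move=> zZ wZ; rewrite !commgEl conjgM [(((x * z) ^ y) ^ w)%g]fixZ // conjMg.
have -> : (z ^ y = z)%g by rewrite conjgE zZ mulKg.
by rewrite invgM -[RHS](mulKg z) zZ !mulgA.
Qed.

(** A commutator depends only on the classes of its arguments modulo the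
    center. *)
Lemma finite_commutators : finite_modulo_center G ->
  finite_set [set [~ xy.1, xy.2]%g | xy in [set: G * G]].
Proof.
move=> fin; pose K := [set [set (x * z)%g | z in group_center (G:=G)] | x in [set: G]].
pose F (AB : set G * set G) := [~ xget 1%g AB.1, xget 1%g AB.2]%g.
apply: (@sub_finite_set _ _ (F @` (K `*` K))); last exact/finite_image/finite_setX.
move=> _ [[x y] _ <-] /=.
pose co x := [set (x * z)%g | z in group_center (G:=G)].
have co_get t : exists2 z, group_center z & xget 1%g (co t) = (t * z)%g.
  have : co t (xget 1%g (co t)).
    apply: (@xgetPex _ _ (co t)); exists t; exists 1%g; last by rewrite mulg1.
    by move=> u; rewrite /commute mul1g mulg1.
  by move=> [z zZ <-]; exists z.
exists (co x, co y); first by split; [exists x|exists y].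
rewrite /F /=; have [z zZ ->] := co_get x; have [w wZ ->] := co_get y.
exact: commg_center.
Qed.

(** Conjugation by y multiplies c by the central element [~ c, y], so conjugation
    by y ^+ n multiplies it by the n-th power of that element. *)
Lemma commutator_centralX c y n :
  group_center [~ c, y]%g -> group_center [~ c, (y ^+ n)%g]%g.
Proof.
set z := [~ c, y]%g => zZ.
have cy : (c ^ y = c * z)%g by rewrite /z commgEl mulVKg.
have zX k : group_center (z ^+ k)%g by apply: group_centerX.
have cyn : (c ^ (y ^+ n) = c * z ^+ n)%g.
  elim: n => [|n IHn]; first by rewrite !expg0 conjg1 mulg1.
  rewrite expgSr conjgM IHn conjMg cy.
  have -> : ((z ^+ n) ^ y = z ^+ n)%g by rewrite conjgE (zX n y) mulKg.
  by rewrite expgS -mulgA.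
by rewrite commgEl cyn mulKg.
Qed.

End Center.

Section Closure.
Variable G : topologicalGroupType.
Implicit Types x y g c : G.

Lemma mulg_continuous2 (T : topologicalType) (f h : T -> G) :
  continuous f -> continuous h -> continuous (fun t => f t * h t)%g.
Proof.
move=> cf ch t.
apply: (@cvg_comp _ _ _ (fun t => (f t, h t)) (fun p : G * G => (p.1 * p.2)%g)).
  exact: cvg_pair (cf t) (ch t).
exact: (mulg_continuous (f t, h t)).
Qed.

(** Centralizers are closed in a Hausdorff group. *)
Lemma commutes_generators_central g c : hausdorff_space G ->
  closure (generated_subgroup (conjugacy_class g)) = [set: G] ->
  (forall t, commute c (g ^ t)%g) -> group_center c.
Proof.
move=> hG gen cg x.
have clC : closed [set x | commute c x].
  rewrite (_ : [set x | _] = (fun x => [~ c, x]%g) @^-1` [set 1%g]); last first.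
    by apply/seteqP; split => y /= h; [apply/eqP/commgP|apply/commgP/eqP].
  apply: closed_comp; last exact/accessible_closed_set1/hausdorff_accessible.
  move=> y _; rewrite /commg /conjg.
  have cst k : continuous (fun _ : G => k : G) by move=> ?; apply: cvg_cst.
  have idc : continuous (fun y : G => y) by move=> ?; apply: cvg_id.
  move: y; apply: mulg_continuous2 => //.
  apply: mulg_continuous2; last exact: mulg_continuous2.
  exact: invg_continuous.
pose S := [pred y : G | `[< commute c y >]].
have : [set: G] x by []; rewrite -gen => xcl.
apply: clC; apply: closure_subset xcl => y /(_ S) h.
have /asboolP// : y \in S.
apply: h => [|_ [t _ <-]]; last exact/asboolP/cg.
split; first by apply/asboolP; apply: commute1.
by move=> a b /asboolP ca /asboolP cb; apply/asboolP/commuteM => //; apply: commuteV.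
Qed.

End Closure.

Lemma finite_argmin (T : choiceType) (R : realType) (A : set T)
    (P : T -> Prop) (F : T -> R) :
  finite_set A -> (exists2 x, A x & P x) ->
  exists x, [/\ A x, P x & forall y, A y -> P y -> F x <= F y].
Proof.
move=> /finite_seqP[s ->].
elim: s => [|a s IHs] [x /= xs Px]; first by [].
have [Ps|nPs] := pselect (exists2 x, x \in s & P x); last first.
  exists a; split; rewrite ?inE ?eqxx //.
    by move: xs; rewrite inE => /orP[/eqP <-//|xs]; case: nPs; exists x.
  by move=> y; rewrite /= inE => /orP[/eqP ->//|ys Py]; case: nPs; exists y.
have [b [/= bs Pb bmin]] := IHs Ps.
have [[Pa ab]|nab] := pselect (P a /\ F a <= F b).
  exists a; split; rewrite /= ?inE ?eqxx //.
  by move=> y; rewrite inE => /orP[/eqP ->//|ys Py]; apply: le_trans (bmin _ ys Py).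
exists b; split; rewrite /= ?inE ?bs ?orbT //.
move=> y; rewrite inE => /orP[/eqP -> Pa|]; last exact: bmin.
by rewrite leNgt; apply/negP => /ltW ab; apply: nab.
Qed.

(** * Contraction of commutators by almost scalar elements *)

Section AlmostScalar.
Variables (R : realType) (G : topologicalGroupType) (V : vectType R[i]).
Variable rho : G -> 'End(V).
Local Notation idV := (\1%VF : 'End(V)).
Implicit Types (A f : 'End(V)) (a s : R[i]) (g x c t : G).
Hypothesis rep : is_representation rho.
Variable nu : 'End(V) -> R.
Hypothesis nuP : biinvariant_norm rho nu.

Definition mult_bound f (d : R) := forall A,
  nu (f \o A)%VF <= d * nu A /\ nu (A \o f)%VF <= d * nu A.

Lemma mult_bound_conj x s d t : mult_bound (rho x - s *: idV) d ->
  mult_bound (rho (x ^ t)%g - s *: idV) d.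
Proof.
move=> h.
have -> : rho (x ^ t)%g - s *: idV =
    (rho (t^-1)%g \o ((rho x - s *: idV) \o rho t))%VF.
  rewrite comp_lfunDl comp_lfunDr comp_lfunNl comp_lfunNr -comp_lfunZl comp_lfun1l.
  by rewrite -comp_lfunZr -!(repM rep) mulVg (rep1 rep).
move=> A; split.
  rewrite -!comp_lfunA (binormMl nuP).
  by apply: le_trans (h _).1 _; rewrite (binormMl nuP).
rewrite !comp_lfunA (binormMr nuP).
by apply: le_trans (h _).2 _; rewrite (binormMr nuP).
Qed.

(** [~ c, x] - 1 is (x c)^-1 (c x - x c), and c x - x c is unchanged when
    scalars are subtracted from c and x: it equals C D - D C with C = c - 1 and
    D = x - s. *)
Lemma commutator_contraction c x s d : mult_bound (rho x - s *: idV) d ->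
  nu (rho [~ c, x]%g - idV) <= 2 * d * nu (rho c - idV).
Proof.
move=> h; set D := rho x - s *: idV in h; set C := rho c - idV.
have -> : rho [~ c, x]%g - idV =
    (rho ((x * c)^-1)%g \o ((C \o D) - (D \o C)))%VF.
  have -> : ((C \o D) - (D \o C) = rho (c * x)%g - rho (x * c)%g)%VF.
    rewrite !(repM rep) /C /D !comp_lfunDl !comp_lfunDr !comp_lfunNl !comp_lfunNr.
    rewrite -!comp_lfunZl -!comp_lfunZr !comp_lfun1l !comp_lfun1r.
    have cancel (U : zmodType) (p q a b e : U) :
        p - a + (- b + e) - (q - b + (- a + e)) = p - q.
      by rewrite -(addrA p) -(addrA q) (addrCA (- b)) opprD addrACA subrr addr0.
    by rewrite !opprK cancel.
  rewrite comp_lfunDr comp_lfunNr -!(repM rep) mulVg (rep1 rep) commgEl conjgE.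
  by rewrite invgM !mulgA.
rewrite (binormMl nuP); apply: le_trans (binormD nuP _ _) _.
rewrite (binormN nuP) -mulrA mulr_natl mulr2n.
by apply: lerD; [apply: (h _).2|apply: (h _).1].
Qed.

(** Take for c a noncentral commutator closest to 1: its commutator with a
    conjugate of x is a commutator closer to 1, hence central.  When all
    commutators are central, any noncentral c will do. *)
Lemma almost_scalar_centralizes x s d :
  injective rho -> finite_modulo_center G ->
  mult_bound (rho x - s *: idV) d -> 2 * d < 1 ->
  (exists g, ~ group_center g) ->
  exists2 c, ~ group_center c & forall t, group_center [~ c, (x ^ t)%g]%g.
Proof.
move=> inj fin h d1 [g ng].
pose K := [set [~ xy.1, xy.2]%g | xy in [set: G * G]].
have [[c0 Kc0 nc0]|none] := pselect (exists2 c, K c & ~ group_center c); last first.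
  exists g => // t; apply: contrapT => nz; apply: none.
  by exists [~ g, (x ^ t)%g]%g => //; exists (g, (x ^ t)%g).
have [c [Kc nc cmin]] := @finite_argmin G R K (fun c => ~ group_center c)
  (fun c => nu (rho c - idV)) (finite_commutators fin) (ex_intro2 _ _ c0 Kc0 nc0).
exists c => // t; apply: contrapT => nz.
have := cmin [~ c, (x ^ t)%g]%g; apply/not_implyP; split.
  by exists (c, (x ^ t)%g).
move=> /(_ nz); apply/negP; rewrite -ltNge.
apply: le_lt_trans (commutator_contraction c (mult_bound_conj t h)) _.
rewrite -[ltRHS]mul1r ltr_pM2r //; apply: (binorm_gt0 nuP).
rewrite subr_eq0; apply/eqP => c1; apply: nc.
by apply: (scalar_center rep inj (a := 1)); rewrite scale1r.
Qed.

(** If [~ g, c] acts as the scalar w, then rho c maps an eigenvector of rho g with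
    eigenvalue b to one with eigenvalue w b, so the spectrum is stable under
    multiplication by w.  As g ^+ n commutes with c, w is an n-th root of unity. *)
Lemma central_commutator_cycle g c n : irreducible_representation rho ->
  injective rho -> (0 < n)%N -> group_center (g ^+ n)%g ->
  group_center [~ g, c]%g -> ~ commute c g ->
  (exists a, a != 0 /\ spectrum (rho g) a) ->
  ~ no_cycle (spectrum (rho g)).
Proof.
move=> irr inj n0 gn zZ ncomm [a [a0 ga]] noc.
have [w zw] := center_scalar rep irr zZ.
have gc : (rho g \o rho c = w *: (rho c \o rho g))%VF.
  have -> : (rho g \o rho c = rho (c * g)%g \o rho [~ g, c]%g)%VF.
    by rewrite -!(repM rep) -commgC.
  by rewrite zw -comp_lfunZr comp_lfun1r (repM rep).
have w1 : w != 1.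
  apply/eqP => w1; apply: ncomm; rewrite /commute; apply: inj.
  by rewrite !(repM rep) gc w1 scale1r.
have gcn k : (rho (g ^+ k)%g \o rho c = w ^+ k *: (rho c \o rho (g ^+ k)%g))%VF.
  elim: k => [|k IHk].
    by rewrite expg0 (rep1 rep) comp_lfun1l comp_lfun1r expr0 scale1r.
  rewrite expgSr (repM rep) -comp_lfunA gc -comp_lfunZr comp_lfunA IHk.
  by rewrite -comp_lfunZl scalerA -exprS comp_lfunA.
have wn : w ^+ n = 1.
  have := gcn n; rewrite -!(repM rep) (gn c) => /eqP.
  rewrite -subr_eq0 -{1}[rho _]scale1r -scalerBl scaler_eq0 subr_eq0 eq_sym.
  move=> /orP[/eqP//|r0].
  case: irr => /negP[]; rewrite -subv0; apply/subvP => v _.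
  rewrite -(id_lfunE v) -(rep1 rep) -(mulVg (c * g ^+ n)%g) (repM rep) (eqP r0).
  by rewrite comp_lfun0r lfunE mem0v.
have [k wk kn] := prim_order_exists n0 wn.
have k2 : (2 <= k)%N.
  rewrite ltn_neqAle (prim_order_gt0 wk) andbT; apply: contra_neq w1 => k1.
  by rewrite -(prim_expr_order wk) -k1 expr1.
refine (noc k w a k2 wk a0 _).
move=> _ [l _ <-]; elim: l => [|l IHl]; first by rewrite expr0 mulr1.
rewrite exprSr mulrA; have /leigenvalueP[v v0 gv] := IHl.
apply/leigenvalueP; exists (rho c v).
  apply: contra_neq v0 => cv.
  by rewrite -(id_lfunE v) -(rep1 rep) -(mulVg c) (repM rep) lfunE /= cv linear0.
by rewrite -comp_lfunE gc scale_lfunE comp_lfunE gv linearZ scalerA mulrC.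
Qed.

(** In the spectral resolution of rho(g^j) - s every term has norm at most eps,
    and there are at most N terms. *)
Lemma mult_bound_power g (N : nat) (lambda : 'I_N -> R[i]) n b s j eps :
  irreducible_representation rho -> (0 < n)%N -> rho (g ^+ n)%g = b *: idV ->
  spectrum (rho g) `<=` range lambda -> 0 <= eps ->
  (forall i, normc (lambda i ^+ j - s) <= eps) ->
  mult_bound (rho (g ^+ j)%g - s *: idV) (N%:R * eps).
Proof.
move=> irr n0 gn specl eps0 close.
have [r [P [[ur rE] r1 gP Pl Pr]]] := spectral_resolution rep nuP irr.1 n0 gn.
have szr : (size r <= N)%N.
  rewrite -[N]card_ord -(size_codom lambda).
  apply: uniq_leq_size => // a /rE /specl [i _ <-].
  exact: codom_f.
have rclose a : a \in r -> normc (a ^+ j - s) <= eps.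
  by move=> /rE /specl [i _ <-].
have DE : rho (g ^+ j)%g - s *: idV = \sum_(a <- r) (a ^+ j - s) *: P a.
  rewrite (resolution_power rep j r1 gP) r1 scaler_sumr -sumrB.
  by apply: eq_bigr => a _; rewrite scalerBl.
have bound (F : R[i] -> 'End(V)) A : (forall a, a \in r -> nu (F a) <= nu A) ->
    nu (\sum_(a <- r) (a ^+ j - s) *: F a) <= N%:R * eps * nu A.
  move=> hF; apply: le_trans (binorm_sum nuP _ _ _) _.
  apply: (@le_trans _ _ (\sum_(a <- r) eps * nu A)).
    rewrite big_seq [leRHS]big_seq; apply: ler_sum => a ar; rewrite (binormZ nuP).
    by apply: ler_pM; rewrite ?normc_ge0 ?(binorm_ge0 nuP) ?rclose ?hF.
  rewrite big_const_seq count_predT iter_addr_0 -(mulr_natl (eps * nu A)) mulrA.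
  apply: ler_wpM2r; first exact: (binorm_ge0 nuP).
  by apply: ler_wpM2r => //; rewrite ler_nat.
move=> A; rewrite DE; split.
  have -> : ((\sum_(a <- r) (a ^+ j - s) *: P a) \o A =
      \sum_(a <- r) (a ^+ j - s) *: (P a \o A))%VF.
    apply/lfunP => v; rewrite comp_lfunE !sum_lfunE; apply: eq_bigr => a _.
    by rewrite !scale_lfunE comp_lfunE.
  by apply: bound => a ar; apply: Pl.
have -> : (A \o (\sum_(a <- r) (a ^+ j - s) *: P a) =
    \sum_(a <- r) (a ^+ j - s) *: (A \o P a))%VF.
  apply/lfunP => v; rewrite comp_lfunE !sum_lfunE linear_sum.
  apply: eq_bigr => a _.
  by rewrite !scale_lfunE linearZ comp_lfunE.
by apply: bound => a ar; apply: Pr.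
Qed.

Lemma generator_noncentral g N : irreducible_representation rho -> (2 <= N)%N ->
  (spectrum (rho g) #= `I_N)%card -> ~ group_center g.
Proof.
move=> irr N2 card gZ; have [a ga] := center_scalar rep irr gZ.
have sub : spectrum (rho g) `<=` [set a].
  move=> b /leigenvalueP[v v0]; rewrite ga !lfun_simp /= => /eqP.
  by rewrite -subr_eq0 -scalerBl scaler_eq0 (negbTE v0) orbF subr_eq0 => /eqP.
have : (`I_N #<= `I_1)%card.
  rewrite -(card_le_eql card) -(card_le_eqr (@card_set1 _ a)).
  exact: subset_card_le.
by rewrite card_le_II leqNgt N2.
Qed.

(** If j and M were coprime, g would be a power of g ^+ j modulo the center, so
    the element c that has central commutators with the conjugates of g ^+ j
    would also have central commutators with the conjugates of g, which
    generate the group. *)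
Lemma almost_scalar_power_not_coprime g N (lambda : 'I_N -> R[i]) M b s j eps :
  injective rho -> irreducible_representation rho -> finite_modulo_center G ->
  hausdorff_space G -> (2 <= N)%N -> eigenvalue_property N rho g ->
  spectrum (rho g) `<=` range lambda ->
  (0 < M)%N -> rho (g ^+ M)%g = b *: idV -> 0 <= eps -> 2 * (N%:R * eps) < 1 ->
  (forall i, normc (lambda i ^+ j - s) <= eps) -> (0 < j)%N -> ~~ coprime j M.
Proof.
move=> inj irr fin hG N2 [gen card noc] specl M0 gM eps0 eps1 close j0.
apply/negP => cop.
have nc := generator_noncentral irr N2 card.
have small := mult_bound_power irr M0 gM specl eps0 close.
have [c nZc cj] := almost_scalar_centralizes inj fin small eps1
  (ex_intro _ g nc).
have gMZ : group_center (g ^+ M)%g := scalar_center rep inj gM.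
(* Bezout: km * j = kn * M + 1, so (g ^+ j) ^+ km is g up to the center. *)
have cg t : group_center [~ c, (g ^ t)%g]%g.
  case: (egcdnP M j0) => km kn; rewrite (eqP cop) => kE _.
  have := commutator_centralX km (cj t).
  rewrite -conjXg -expgnA mulnC kE addn1 expgSr mulnC expgnA conjMg.
  have gZ : group_center ((g ^+ M ^+ kn) ^ t)%g.
    by rewrite conjgE (group_centerX kn gMZ) mulKg; apply: group_centerX.
  rewrite (gZ (g ^ t)%g) -[X in [~ X, _]%g]mulg1 commg_center //.
  by move=> y; rewrite /commute mul1g mulg1.
have [t nct] : exists t, ~ commute c (g ^ t)%g.
  apply: contrapT => H; apply: nZc; apply: (commutes_generators_central hG gen) => t.
  by apply: contrapT => nt; apply: H; exists t.
(* Conjugating by t^-1 replaces g ^ t by g itself. *)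
pose c' := (c ^ t^-1)%g.
have gc' : group_center [~ g, c']%g.
  have := group_centerV (cg t); rewrite invgR => h.
  have -> : ([~ g, c'] = [~ g ^ t, c] ^ t^-1)%g by rewrite conjRg conjgK.
  by rewrite conjgE h mulKg.
have [a fa] := eigenvalue_exists (rho g) irr.1.
apply: (central_commutator_cycle (c := c') irr inj M0 gMZ gc' _ _ noc).
  move/commgP/eqP => c'g; apply: nct; apply/commgP.
  have -> : ([~ c, g ^ t] = [~ c', g] ^ t)%g by rewrite conjRg conjgKV.
  by rewrite c'g conj1g.
exists a; split=> //; apply/eqP => a0.
have := modulus_eigenvalue nuP fa.
by rewrite a0 normc0 => /eqP; rewrite eq_sym oner_eq0.
Qed.

End AlmostScalar.

(** * The bound on the smallest order of a root of unity *)

(** By minimality of M some u i ^+ (M / p) is not 1, and its p-th power is 1. *)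
Lemma prime_order_in_generated (R : realType) (I : finType) (u : I -> R[i])
    (S0 : set R[i]) M p :
  (0 < M)%N -> (forall i, u i ^+ M = 1) ->
  (forall k, (0 < k < M)%N -> exists i, u i ^+ k != 1) ->
  (forall i, S0 (u i)) -> prime p -> (p %| M)%N ->
  exists2 z, generated_mulgroup S0 z & p.-primitive_root z.
Proof.
move=> M0 uM Mmin uS pp pM.
have [|i ui] := Mmin (M %/ p)%N.
  by rewrite divn_gt0 ?prime_gt0 // dvdn_leq //= ltn_Pdiv // prime_gt1.
exists (u i ^+ (M %/ p)%N).
  move=> S Sdiv SS0; have S1 : 1 \in S by case: Sdiv.
  have uiS : u i \in S by apply: SS0.
  elim: (M %/ p)%N => [|k IHk]; first by rewrite expr0.
  by rewrite exprSr; apply: (GRing.divr_closedM Sdiv).2.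
have zp : (u i ^+ (M %/ p)%N) ^+ p = 1 by rewrite -exprM divnK.
have [d zd dp] := prim_order_exists (prime_gt0 pp) zp.
have /orP[/eqP d1|/eqP dp1] : (d == 1%N) || (d == p) by case/primeP: pp => _; apply.
  by move: ui; rewrite -(prim_expr_order zd) d1 expr1 eqxx.
by rewrite dp1 in zd.
Qed.

Theorem theorem4p2 (R : realType) (N : nat) (hN : (2 <= N)%N) :
  exists m : nat,
    forall (G : topologicalGroupType) (V : vectType R[i])
           (rho : G -> 'End(V)) (g : G) (lambda : 'I_N -> R[i]),
      is_pair rho ->
      eigenvalue_property N rho g ->
      range lambda = spectrum (rho g) ->
      finite_modulo_center G ->
      exists (z : R[i]) (n : nat),
        [/\ generated_mulgroup
              [set lambda ij.1 / lambda ij.2 | ij in [set: 'I_N * 'I_N]] z,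
            n.-primitive_root z & (1 < n < m)%N].
Proof.
have N0 : (0 < N)%N by apply: leq_trans hN.
have NR : 0 < N%:R :> R by rewrite ltr0n.
(* With this eps the contraction factor 2 * (N * eps) of commutators is 1/2. *)
pose eps : R := (4 * N%:R)^-1.
have eps0 : 0 < eps by rewrite invr_gt0 mulr_gt0.
have [Q approx] := simultaneous_approximation N eps0.
exists Q.+1 => G V rho g lambda [[[hG _] cG] [rep inj irr]] gP specE fin.
have [nu nuP] := biinvariant_norm_exists cG rep irr.1.
have lamE i : spectrum (rho g) (lambda i) by rewrite -specE; exists i.
have lam1 i : normc (lambda i) = 1 by apply: (modulus_eigenvalue nuP (lamE i)).
pose i0 := Ordinal N0.
have lam0 i : lambda i != 0.
  apply/eqP => l0; have := lam1 i.
  by rewrite l0 normc0 => /eqP; rewrite eq_sym oner_eq0.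
pose u i := lambda i / lambda i0.
have u1 i : normc (u i) = 1 by rewrite normcM normcV !lam1 invr1 mulr1.
have [n n0 gnZ] := finite_order_mod_center g fin.
have [b gn] := center_scalar rep irr gnZ.
have lamn i : lambda i ^+ n = b.
  have /leigenvalueP[v v0 gv] := lamE i.
  pose A : 'End(V) := projv <[v]>%VS.
  have gA : (rho g \o A = lambda i *: A)%VF.
    apply/lfunP => w; rewrite comp_lfunE scale_lfunE.
    have /vlineP[k ->] := memv_proj <[v]>%VS w.
    by rewrite linearZ /= gv !scalerA mulrC.
  have := congr1 (fun f : 'End(V) => f v) (repX_eigen rep n gA).
  rewrite /= gn -comp_lfunZl comp_lfun1l !scale_lfunE projv_id ?memv_line //.
  move/eqP; rewrite -subr_eq0 -scalerBl scaler_eq0 (negbTE v0) orbF.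
  by rewrite subr_eq0 => /eqP.
have exM : exists k, (0 < k)%N && [forall i, u i ^+ k == 1].
  exists n; rewrite n0; apply/forallP => i.
  by rewrite expr_div_n !lamn divff // -(lamn i0) expf_neq0.
case: (ex_minnP exM) => M /andP[M0 /forallP uM] Mmin.
have lamM i : lambda i ^+ M = lambda i0 ^+ M.
  have := uM i; rewrite expr_div_n => /eqP h.
  by rewrite -[LHS](divfK (expf_neq0 M (lam0 i0))) h mul1r.
have gM : rho (g ^+ M)%g = lambda i0 ^+ M *: (\1%VF : 'End(V)).
  have [r [P [[ur rE] r1 gPr _ _]]] := spectral_resolution rep nuP irr.1 n0 gn.
  rewrite (resolution_power rep M r1 gPr) r1 scaler_sumr.
  apply: eq_big_seq => a /rE; rewrite -/(spectrum (rho g) a).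
  have -> : passmx.leigenvalue (rho g) a = spectrum (rho g) a :> Prop by [].
  by rewrite -specE => -[i _ <-]; rewrite lamM.
have [j /andP[j0 jQ] close] := approx u u1.
have close' i : normc (lambda i ^+ j - lambda i0 ^+ j) <= eps.
  have -> : lambda i ^+ j - lambda i0 ^+ j = (u i ^+ j - 1) * lambda i0 ^+ j.
    by rewrite mulrBl mul1r -exprMn divfK.
  by rewrite normcM normcX lam1 expr1n mulr1.
have specl : spectrum (rho g) `<=` range lambda by rewrite specE.
have small : 2 * (N%:R * eps) < 1.
  rewrite /eps invfM [N%:R * _]mulrCA divff ?gt_eqF // mulr1.
  by rewrite ltr_pdivrMr // mul1r ltr_nat.
have ncop := almost_scalar_power_not_coprime rep nuP inj irr fin hG hN gP specl
  M0 gM (ltW eps0) small close' j0.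
pose p := pdiv (gcdn j M).
have gcd1 : (1 < gcdn j M)%N by rewrite ltn_neqAle eq_sym ncop gcdn_gt0 j0.
have pp : prime p := pdiv_prime gcd1.
have pj : (p %| j)%N := dvdn_trans (pdiv_dvd _) (dvdn_gcdl _ _).
have pM : (p %| M)%N := dvdn_trans (pdiv_dvd _) (dvdn_gcdr _ _).
have [|||z zG zp] := @prime_order_in_generated R _ u
  [set lambda ij.1 / lambda ij.2 | ij in [set: 'I_N * 'I_N]] M p M0 _ _ _ pp pM.
- by move=> i; apply/eqP.
- move=> k /andP[k0 kM]; apply/existsP; rewrite -negb_forall.
  by apply/negP => h; have := Mmin k; rewrite k0 h leqNgt kM => /(_ isT).
- by move=> i; exists (i, i0).
exists z, p; split=> //; rewrite prime_gt1 //= ltnS.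
by apply: leq_trans jQ; apply: dvdn_leq.
Qed.
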